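(* Let $H=(V,S)$ be a signed hypergraph of rank $r$. For each $s\in S$, among all maximal signed edges of $H$ containing $s$, denote by $f_s$ one with minimum cardinality. Let $k$ be such that $$\mathrm{gap}(\{s,f_s\})\le k\qquad\forall s\in S.$$ Denote by $\bar S$ the set of maximal signed edges of $H$. If the underlying hypergraph of $(V,\bar S)$ is $\beta$-acyclic, then $\mathcal P_{pB}(H)$ has an extended formulation with $O(r2^k|V||S|)$ variables and inequalities. In particular, if $k=O(\log\mathrm{poly}(|V|,|S|))$, then $\mathcal P_{pB}(H)$ has a polynomial-size extended formulation. Moreover, all coefficients and right-hand side constants in the system defining $\mathcal P_{pB}(H)$ (i.e., in this extended formulation) are $0,\pm 1$.
   Context: A hypergraph is a pair $(V,E)$ with $V$ a finite set of nodes and $E$ a set of edges, which are subsets of $V$ of cardinality at least two. A signed hypergraph $H$ is a pair $(V,S)$ with $V$ a finite set of nodes and $S$ a set of signed edges. A signed edge is a pair $s=(e,\eta_s)$ with $e\subseteq V$, $|e|\ge 2$, and $\eta_s:e\to\{-1,+1\}$; $e$ is its underlying edge. No two signed edges of $S$ are identical (same $e$ and same $\eta_s$), but signed edges may be parallel (same $e$). Set-theoretic notation for $s$ (cardinality, containment) refers to its underlying edge. The underlying hypergraph of $H$ is obtained by ignoring signs and dropping parallel edges. The rank of a (signed) hypergraph is the maximum cardinality of any of its (signed) edges. A signed edge $s\in S$ is maximal if there is no $s'\in S$ with $s'\supset s$ (strict containment of underlying edges). Gap: for a set $E'$ of edges, $\mathrm{gap}(E'):=\max\{|\bigcup_{f\in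 E'}f|-|e|: e\in E'\}$; for a set $S'$ of signed edges, $\mathrm{gap}(S')$ is the gap of the set of underlying edges of the elements of $S'$. For a hypergraph $G=(V,E)$ and $v\in V$, $G-v$ is the hypergraph with node set $V\setminus\{v\}$ and edge set $\{e\setminus\{v\}: e\in E,\ |e\setminus\{v\}|\ge 1\}$. A node $v$ is a $\beta$-leaf of $G$ if the set of edges of $G$ containing $v$ is totally ordered by inclusion. $G$ is $\beta$-acyclic if there is an ordering $v_1,\dots,v_n$ of all its nodes such that $v_1$ is a $\beta$-leaf of $G$, $v_2$ is a $\beta$-leaf of $G-v_1$, and so on, until $v_n$ is a $\beta$-leaf of $G-v_1-\cdots-v_{n-1}$. For a signed edge $s$ and $v\in s$, let $\sigma_s(z_v):=z_v$ if $\eta_s(v)=+1$ and $\sigma_s(z_v):=1-z_v$ if $\eta_s(v)=-1$. The pseudo-Boolean set is $\mathcal S_{pB}(H):=\{z\in\{0,1\}^{V\cup S}: z_s=\prod_{v\in s}\sigma_s(z_v)\ \forall s\in S\}$, and the pseudo-Boolean polytope $\mathcal P_{pB}(H)$ is its convex hull. An extended formulation of $\mathcal P_{pB}(H)$ is a finite system of linear inequalities and equalities in variables $(z,y)$, with $z$ indexed by $V\cup S$ and $y$ a vector of additional variables, whose solution set projects onto $\mathcal P_{pB}(H)$ in the $z$-space. It is polynomial-size if its number of variables and constraints is bounded by a polynomial in $|V|,|S|$. $\mathrm{poly}(|V|,|S|)$ denotes a polynomial function of $|V|,|S|$; the asymptotic statement is understood over a family of instances with a fixed polynomial and fixed $O$-constant,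 the resulting polynomial size bound being uniform over the family. *)

(* Defs.v *)
From HB Require Import structures.
From mathcomp Require Import all_boot all_order all_algebra.

Set Implicit Arguments.
Unset Strict Implicit.
Unset Printing Implicit Defensive.

Import Order.TTheory GRing.Theory Num.Theory.

Local Open Scope ring_scope.

(* The condition that edges have at least two nodes is not part of this record:
   deleting nodes may leave edges of cardinality one. *)
Record hypergraph (V : finType) := Hypergraph {
  nodes : {set V};
  edges : {set {set V}} }.

Definition del_node (V : finType) (G : hypergraph V) (v : V) : hypergraph V :=
  Hypergraph (nodes G :\ v)
    [set e :\ v | e in [set e in edges G | (1 <= #|e :\ v|)%N]].

Definition beta_leaf (V : finType) (G : hypergraph V) (v : V) : bool :=
  [forall e in edges G, forall e' in edges G,
     (v \in e) ==> (v \in e') ==> (e \subset e') || (e' \subset e)].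

Fixpoint beta_elim (V : finType) (G : hypergraph V) (o : seq V) : bool :=
  if o is v :: o' then beta_leaf G v && beta_elim (del_node G v) o' else true.

Definition beta_acyclic (V : finType) (G : hypergraph V) : Prop :=
  exists2 o : seq V, perm_eq o (enum (nodes G)) & beta_elim G o.

Definition gap (V : finType) (E : {set {set V}}) : nat :=
  \max_(e in E) (#|\bigcup_(f in E) f| - #|e|)%N.

(* A signed edge (e, eta) is encoded as a partial function on the nodes:
   eta v = +1 is Some true, eta v = -1 is Some false, and None off e. *)
Record sedge (V : finType) := SEdge {
  sgn : {ffun V -> option bool};
  sedge_card : (2 <= #|[set v | isSome (sgn v)]|)%N }.

HB.instance Definition _ (V : finType) := [isSub for @sgn V].
HB.instance Definition _ (V : finType) := [Finite of sedge V by <:].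

Definition uedge (V : finType) (s : sedge V) : {set V} :=
  [set v | isSome (sgn s v)].

Definition sgap (V : finType) (S : {set sedge V}) : nat :=
  gap [set uedge s | s in S].

Definition underlying (V : finType) (S : {set sedge V}) : hypergraph V :=
  Hypergraph [set: V] [set uedge s | s in S].

Definition srank (V : finType) (S : {set sedge V}) : nat :=
  \max_(s in S) #|uedge s|.

Definition maximal (V : finType) (S : {set sedge V}) : {set sedge V} :=
  [set s in S | [forall s' in S, ~~ (uedge s \proper uedge s')]].

Definition min_maximal_over (V : finType) (S : {set sedge V})
    (s t : sedge V) : Prop :=
  [/\ t \in maximal S, uedge s \subset uedge t &
      forall t', t' \in maximal S -> uedge s \subset uedge t' ->
        (#|uedge t| <= #|uedge t'|)%N].

Definition pbvar (V : finType) (S : {set sedge V}) : finType :=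
  (V + {s : sedge V | s \in S})%type.

From mathcomp Require Import all_classical all_reals.

Section Polyhedra.
Variable R : realType.

Definition conv_hull (E : lmodType R) (X : set E) : set E :=
  [set x : E | exists (n : nat) (l : 'I_n -> R) (u : 'I_n -> E),
     [/\ forall i, 0 <= l i, \sum_i l i = 1, forall i, X (u i) &
         x = \sum_i l i *: u i]]%classic.

(* The value 1 off the underlying edge is never used. *)
Definition literal (V : finType) (s : sedge V) (v : V) (x : R) : R :=
  match sgn s v with
  | Some true => x
  | Some false => 1 - x
  | None => 1
  end.

Definition pb_set (V : finType) (S : {set sedge V}) :
    set {ffun pbvar S -> R^o} :=
  [set z : {ffun pbvar S -> R^o} | (forall i, z i = 0 \/ z i = 1) /\
     forall s : {s : sedge V | s \in S},
       z (inr s) = \prod_(v in uedge (val s)) literal (val s) v (z (inl v))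
  ]%classic.

Definition pb_polytope (V : finType) (S : {set sedge V}) :
    set {ffun pbvar S -> R^o} :=
  conv_hull (@pb_set V S).

Record lin_constraint (J : Type) := LinConstraint {
  lhs : J -> R;
  is_eqn : bool;  (* lhs = rhs if true, lhs <= rhs if false *)
  rhs : R }.

Definition satisfies (I J : finType) (z : {ffun I -> R^o})
    (y : {ffun J -> R^o}) (c : lin_constraint (I + J)) : bool :=
  let a := \sum_i lhs c (inl i) * z i + \sum_j lhs c (inr j) * y j in
  if is_eqn c then a == rhs c else a <= rhs c.

Record lin_system (I : finType) := LinSystem {
  naux : nat;
  constraints : seq (lin_constraint (I + 'I_naux)) }.

Definition projection (I : finType) (F : lin_system I) :
    set {ffun I -> R^o} :=
  [set z : {ffun I -> R^o} | exists y : {ffun 'I_(naux F) -> R^o},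
     all (satisfies z y) (constraints F)]%classic.

Definition extended_formulation (I : finType) (F : lin_system I)
    (P : set {ffun I -> R^o}) : Prop :=
  projection F = P.

Definition nvars (I : finType) (F : lin_system I) : nat := (#|I| + naux F)%N.

Definition nconstraints (I : finType) (F : lin_system I) : nat :=
  size (constraints F).

Definition coefs_0_pm1 (I : finType) (F : lin_system I) : bool :=
  all (fun c => (rhs c \in [:: 0; 1; -1]) &&
                [forall j, lhs c j \in [:: 0; 1; -1]]) (constraints F).

End Polyhedra.

Arguments pb_polytope R {V} S.

(* Main.v *)
Require Import Defs.
From HB Require Import structures.
From mathcomp Require Import all_boot all_order all_algebra polyXY.
From mathcomp Require Import all_classical all_reals exp.
From mathcomp Require Import zify.
Set Implicit Arguments.
Unset Strict Implicit.
Unset Printing Implicit Defensive.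
Import Order.TTheory GRing.Theory Num.Theory.
Local Open Scope ring_scope.

(** A point of the pseudo-Boolean polytope is a table of probabilities: for a
    random 0/1 assignment [X] of the nodes it records P(X_v = 1) for each node
    [v], and for each signed edge the probability that [X] makes all its
    literals true.  A signed edge is the same thing as a pattern, that is, a
    partial assignment, and its product of literals is the indicator of the
    event that [X] extends the pattern ([pb_polytopeP]).

    The extended formulation has one additional variable for each pattern of a
    suitable finite list, meant to be the probability of that pattern.  The
    list starts from the patterns that have the underlying edge of some [f s]
    as their support and extend [s].  Since the gap of [s] and [f s] is at most
    [k], each [s] contributes at most [2 ^ k] of them, and the probability of
    [s] is the sum of theirs ([law_completions]).  All these supports are
    maximal edges, so they form a beta-acyclic hypergraph.

    It remains to say when numbers attached to these patterns are the
    probabilities of some random assignment.  The nodes are eliminated in the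
    order given by beta-acyclicity.  Let [v] be the current node, and let the
    bases be the patterns that contained [v], with [v] removed, together with
    the empty pattern.  As [v] is a beta-leaf, the supports of the bases are
    nested, hence two bases with a common extension are comparable: the events
    they describe form a laminar family.  Given a random assignment of the
    other nodes with the right probabilities on the bases, one chooses the
    value of [v] at random, with a conditional law that depends only on the
    smallest event of the laminar family that has occurred.  This succeeds if
    and only if, for each base [t] and each sign, the prescribed probability of
    [t] with that sign at [v] is at least the sum of those of the children of
    [t] in the laminar forest, and the two signs add up to the probability of
    [t] ([law_extend] for sufficiency, [law_split] and [law_children] for
    necessity).  These are three rows with coefficients 0, 1 and -1 for each
    base, and there are at most [1 + #|S| * 2 ^ k] bases for each node.
    Induction on the elimination order gives [rows_sound] and
    [rows_complete].

    The polynomial bound follows because [k <= c * ln u] forces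
    [2 ^ k <= expR k <= u ^ c] as soon as [u] is larger than 1. *)

(** * Patterns *)

Notation pattern V := {ffun V -> option bool}.

Section Patterns.
Variable V : finType.
Implicit Types (p q c : pattern V) (v : V) (x : V -> bool).

(** For the sign function of a signed edge this is its underlying edge. *)
Definition supp p : {set V} := [set v | isSome (p v)].

Definition blank : pattern V := [ffun=> None].

Definition upd p v o : pattern V := [ffun u => if u == v then o else p u].

Definition full x : pattern V := [ffun v => Some (x v)].

(** Extension of partial assignments; the event described by a pattern [p] is
    [ple p (full x)]. *)
Definition ple p q := [forall v, (p v == None) || (q v == p v)].

Lemma pleP p q : reflect (forall v b, p v = Some b -> q v = Some b) (ple p q).
Proof.
apply: (iffP forallP) => [le_pq v b pv | le_pq v].
  by have := le_pq v; rewrite pv => /eqP.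
by case pv: (p v) => [b|//]; rewrite (le_pq v b pv) eqxx orbT.
Qed.

Lemma suppP p v : reflect (exists b, p v = Some b) (v \in supp p).
Proof.
by rewrite inE; case: (p v) => [b|]; constructor; [exists b | case].
Qed.

Lemma ple_refl p : ple p p.
Proof. by apply/pleP. Qed.

Lemma ple_trans q p c : ple p q -> ple q c -> ple p c.
Proof.
by move=> /pleP pq /pleP qc; apply/pleP => v b /pq /qc.
Qed.

Lemma blank_ple p : ple blank p.
Proof. by apply/pleP => v b; rewrite ffunE. Qed.

Lemma ple_supp p q : ple p q -> supp p \subset supp q.
Proof.
move=> /pleP pq; apply/fintype.subsetP => v /suppP [b pv]; apply/suppP.
by exists b; apply: pq.
Qed.

Lemma ple_card p q : ple p q -> (#|supp q| <= #|supp p|)%N -> p = q.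
Proof.
move=> pq le_qp; have eq_supp: supp p = supp q.
  by apply/eqP; rewrite eqEcard ple_supp.
apply/ffunP => v; case pv: (p v) => [b|].
  by rewrite (pleP _ _ pq v b pv).
have: v \notin supp q by rewrite -eq_supp inE pv.
by rewrite inE; case: (q v).
Qed.

Lemma ple_anti p q : ple p q -> ple q p -> p = q.
Proof. by move=> pq qp; apply: ple_card => //; apply/subset_leq_card/ple_supp. Qed.

(** Two patterns with a common extension agree wherever both are defined, so
    only their supports matter for comparing them; this is how nested edges
    turn into a laminar family of events. *)
Lemma ple_common p q c :
  ple p c -> ple q c -> supp p \subset supp q -> ple p q.
Proof.
move=> /pleP pc /pleP qc /fintype.subsetP spq; apply/pleP => v b pv.
have /suppP[b' qv]: v \in supp q by apply: spq; apply/suppP; exists b.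
by rewrite qv -(qc _ _ qv) (pc _ _ pv).
Qed.

Lemma supp_upd p v b : supp (upd p v (Some b)) = v |: supp p.
Proof. by apply/setP => u; rewrite !inE ffunE; case: eqP. Qed.

Lemma supp_erase p v : supp (upd p v None) = supp p :\ v.
Proof. by apply/setP => u; rewrite !inE ffunE; case: eqP. Qed.

Lemma updK p v o o' : p v = o' -> upd (upd p v o) v o' = p.
Proof.
by move=> pv; apply/ffunP => u; rewrite !ffunE; case: eqP => // ->.
Qed.

Lemma upd_id p v : upd p v (p v) = p.
Proof. by apply/ffunP => u; rewrite !ffunE; case: eqP => // ->. Qed.

Lemma upd_ple p v b x : p v = None ->
  ple (upd p v (Some b)) (full x) = ple p (full x) && (x v == b).
Proof.
move=> pv; apply/pleP/andP => [le_px | [/pleP le_px /eqP xv] u d].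
  split; last first.
    by have := le_px v b; rewrite !ffunE eqxx => /(_ erefl) [->].
  apply/pleP => u d pu; apply: le_px; rewrite ffunE.
  by case: eqP => // uv; rewrite -uv pu in pv.
rewrite ffunE; case: eqP => [-> [<-]|_ /le_px //].
by rewrite ffunE xv.
Qed.

Lemma ple_full_except p v x y : p v = None -> (forall u, u != v -> x u = y u) ->
  ple p (full x) = ple p (full y).
Proof.
move=> pv xy; apply/pleP/pleP => le_p u b pu;
  have := le_p u b pu; rewrite !ffunE => <-; congr Some;
  [apply: esym|]; apply: xy; apply/eqP => uv; by rewrite uv pv in pu.
Qed.

Lemma single_ple v b x : ple (upd blank v (Some b)) (full x) = (x v == b).
Proof. by rewrite upd_ple ?ffunE // blank_ple. Qed.

End Patterns.

Arguments blank {V}.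

(** * Laminar families and Moebius inversion *)

Section Laminar.
Variables (V : finType) (B : {set pattern V}).
Hypotheses (B_blank : blank \in B)
  (B_nested : {in B &, forall p q,
     (supp p \subset supp q) || (supp q \subset supp p)}).
Implicit Types (p q s t c : pattern V).

(** Patterns of the family below a common pattern form a chain, so maximizing
    the size of the support yields a greatest element and not only a maximal
    one. *)
Definition greatest (D : pred (pattern V)) : pattern V :=
  [arg max_(s > blank | (s \in B) && D s) #|supp s|].

(** For a total [c], the smallest event of the family containing [c]: the cells
    partition the assignments. *)
Definition cell c := greatest (fun s => ple s c).

(** Only meaningful for [c != blank], the root of the forest. *)
Definition parent c := greatest (fun s => ple s c && (s != c)).

Lemma greatestP (D : pred (pattern V)) c :
    D blank -> (forall s, D s -> ple s c) ->
  [/\ greatest D \in B, D (greatest D) &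
      forall s, s \in B -> D s -> ple s (greatest D)].
Proof.
move=> Df Dc; rewrite /greatest; case: arg_maxnP => [|s /andP[Bs Ds] s_max].
  by rewrite B_blank.
split=> // q Bq Dq; have le_qs: (#|supp q| <= #|supp s|)%N.
  by apply: s_max; rewrite Bq.
case/orP: (B_nested Bq Bs) => [sub_qs | sub_sq].
  exact: ple_common (Dc _ Dq) (Dc _ Ds) sub_qs.
have sq: ple s q by apply: ple_common (Dc _ Ds) (Dc _ Dq) sub_sq.
by rewrite (ple_card sq le_qs) ple_refl.
Qed.

Lemma cell_in c : cell c \in B.
Proof. by have [] := @greatestP (fun s => ple s c) c (blank_ple c). Qed.

Lemma ple_cell t c : t \in B -> ple t (cell c) = ple t c.
Proof.
move=> Bt; have [//|_ le_c max_c] := @greatestP (fun s => ple s c) c (blank_ple c).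
by apply/idP/idP => [/ple_trans|]; [apply | apply: max_c].
Qed.

Let parentP c : c != blank -> [/\ parent c \in B,
  ple (parent c) c && (parent c != c) &
  forall s, s \in B -> ple s c && (s != c) -> ple s (parent c)].
Proof.
move=> c_neq; apply: (@greatestP _ c); first by rewrite blank_ple eq_sym.
by move=> s /andP[].
Qed.

Lemma parent_in c : c != blank -> parent c \in B.
Proof. by case/parentP. Qed.

Lemma ple_parent t c : t \in B -> c != blank ->
  ple t (parent c) = ple t c && (t != c).
Proof.
move=> Bt /parentP[_ /andP[le_c neq_c] max_c].
apply/idP/idP => [le_t | ]; last exact: max_c.
rewrite (ple_trans le_t le_c); apply: contraNneq neq_c => tc.
by apply/eqP; apply: ple_anti le_c _; rewrite -[X in ple X _]tc.
Qed.

Definition children t := [set c in B | (c != blank) && (parent c == t)].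

Section Moebius.
Variable R : zmodType.
Implicit Types F G : pattern V -> R.

(** When [F t] is the mass of the assignments extending [t], this is the mass
    of those for which [t] is the largest matched member of the family. *)
Definition atom F t := F t - \sum_(c in children t) F c.

(** Every member strictly above [t] has its parent above or equal to [t], so
    summing atoms over the up-set of [t] telescopes. *)
Lemma sum_atom F t : t \in B -> \sum_(s in B | ple t s) atom F s = F t.
Proof.
move=> Bt; rewrite sumrB.
rewrite [X in _ - X](eq_bigr (fun s => \sum_(c | ((c \in B) && (c != blank) &&
   ple t (parent c)) && (parent c == s)) F c)); last first.
  move=> s /andP[_ ts]; apply: eq_bigl => c; rewrite inE -!andbA.
  by case: (parent c =P s) => [->|_]; rewrite ?ts ?andbF.
rewrite -(partition_big parent (fun s => (s \in B) && ple t s)); last first.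
  by move=> c /andP[/andP[_ c_neq] ->]; rewrite parent_in.
rewrite (bigD1 t) /=; last by rewrite Bt ple_refl.
rewrite [X in _ + X - _](eq_bigl (fun c =>
  ((c \in B) && (c != blank) && ple t (parent c)))) ?addrK //.
move=> c; case Bc: (c \in B) => //=; have [->|c_neq] := eqVneq c blank.
  apply/andP => -[tf]; rewrite eq_sym; case/eqP; apply: ple_anti => //.
  exact: blank_ple.
by rewrite ple_parent // eq_sym.
Qed.

(** [atom F] and [G] have the same sums over all up-sets, so they agree by
    induction from the largest patterns down. *)
Lemma atom_unique F G :
    {in B, forall t, F t = \sum_(s in B | ple t s) G s} ->
  {in B, forall t, atom F t = G t}.
Proof.
move=> FG.
have d0 t: t \in B -> \sum_(s in B | ple t s) (atom F s - G s) = 0.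
  by move=> Bt; rewrite sumrB sum_atom // -FG // subrr.
move=> t Bt; apply/eqP; rewrite -subr_eq0; apply/eqP.
have [n] := ubnP (#|V| - #|supp t|); elim: n t Bt => // n IHn t Bt.
rewrite ltnS => le_n; have := d0 t Bt; rewrite (bigD1 t) /=; last first.
  by rewrite Bt ple_refl.
rewrite big1 ?addr0 // => s /andP[/andP[Bs ts] st]; apply: IHn => //.
apply: leq_trans le_n; apply: ltn_sub2l; last first.
  rewrite ltnNge; apply: contra st => le_st.
  by apply/eqP/esym/ple_card.
apply: leq_trans (max_card (mem (supp s))); rewrite ltnNge.
by apply: contra st => le_st; apply/eqP/esym/ple_card.
Qed.

(** An assignment extends [t] exactly when its cell lies above [t], so the
    masses of the cells solve the equations that characterize atoms.  In
    particular the atoms of a nonnegative mass are nonnegative, which is the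
    inequality between a base and its children. *)
Lemma atom_mass (Omega : finType) (w : Omega -> R) (X : Omega -> V -> bool) t :
    t \in B ->
  atom (fun p => \sum_(i | ple p (full (X i))) w i) t =
  \sum_(i | cell (full (X i)) == t) w i.
Proof.
move=> Bt.
apply: (atom_unique
          (G := fun s => \sum_(i | cell (full (X i)) == s) w i) _ Bt) => {}t {}Bt.
rewrite (partition_big (fun i => cell (full (X i)))
           (fun s => (s \in B) && ple t s)) /=; last first.
  by move=> i ti; rewrite cell_in ple_cell.
apply: eq_bigr => s /andP[_ ts]; apply: eq_bigl => i.
by rewrite -ple_cell //; case: eqP => [->|]; rewrite ?ts ?andbF.
Qed.

End Moebius.
End Laminar.

(** * Probabilities of patterns *)

Section Laws.
Variables (R : realType) (V : finType).
Implicit Types (p q t : pattern V) (v : V) (M Y : pattern V -> R).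

(** [M] gives the probability of each pattern under some random assignment [X]
    on a finite probability space with weights [w].  Leaving the space free
    makes it easy to add a coin flip for one more node. *)
Definition law M := exists (Omega : finType) (w : Omega -> R)
    (X : Omega -> V -> bool),
  [/\ forall i, 0 <= w i, \sum_i w i = 1 &
      forall p, M p = \sum_(i | ple p (full (X i))) w i].

Lemma law_const x : law (fun p => (ple p (full x))%:R).
Proof.
exists unit, (fun=> 1), (fun=> x); split=> [//||p].
  by rewrite big_const card_unit /= addr0.
by rewrite big_mkcond big_const card_unit /= addr0; case: ple.
Qed.

Lemma law_blank M : law M -> M blank = 1.
Proof.
move=> [Omega [w [X [_ w1 ->]]]]; rewrite -[RHS]w1.
by apply: eq_bigl => i; rewrite blank_ple.
Qed.

Lemma law_split M p v : law M -> p v = None ->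
  M (upd p v (Some true)) + M (upd p v (Some false)) = M p.
Proof.
move=> [Omega [w [X [_ _ Mw]]]] pv; rewrite !Mw [RHS](bigID (fun i => X i v)) /=.
by congr (_ + _); apply: eq_bigl => i; rewrite upd_ple //; case: (X i v).
Qed.

Definition completions (e : {set V}) p : {set pattern V} :=
  [set q | (supp q == e) && ple p q].

(** The events of the completions of [p] on [e] partition the event of [p]: the
    completion followed by an assignment is its restriction to [e]. *)
Lemma law_completions M p (e : {set V}) : law M -> supp p \subset e ->
  M p = \sum_(q in completions e p) M q.
Proof.
move=> [Omega [w [X [_ _ Mw]]]] pe.
pose q i : pattern V := [ffun v => if v \in e then Some (X i v) else None].
have supp_q i : supp (q i) = e.
  by apply/setP => v; rewrite inE ffunE; case: ifP.
have q_full i : ple (q i) (full (X i)).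
  by apply/pleP => v b; rewrite !ffunE; case: ifP.
rewrite Mw (partition_big q (mem (completions e p))) /=; last first.
  move=> i p_le; rewrite inE supp_q eqxx /=.
  by apply: ple_common p_le (q_full i) _; rewrite supp_q.
apply: eq_bigr => s; rewrite inE => /andP[/eqP supp_s ps].
rewrite Mw; apply: eq_bigl => i; apply/andP/idP => [[_ /eqP <-]|s_le].
  exact: q_full.
split; first exact: ple_trans ps s_le.
apply/eqP/ple_card; last by rewrite supp_q supp_s.
by apply: ple_common (q_full i) s_le _; rewrite supp_q supp_s.
Qed.

(** A completion is determined by the nodes outside [supp p] that it sets to
    true. *)
Lemma card_completions (e : {set V}) p : supp p \subset e ->
  (#|completions e p| <= 2 ^ (#|e| - #|supp p|))%N.
Proof.
move=> pe; rewrite -{1}(finset.setIidPr pe) -cardsD -card_powerset.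
pose g q : {set V} := [set v in e :\: supp p | q v == Some true].
rewrite -(@card_in_imset _ _ g).
  apply: subset_leq_card; apply/fintype.subsetP => _ /imsetP[q _ ->].
  by rewrite powersetE; apply/fintype.subsetP => v; rewrite inE => /andP[].
move=> q q'; rewrite !inE => /andP[/eqP sq /pleP pq] /andP[/eqP sq' /pleP pq'].
move=> /setP g_eq; apply/ffunP => v.
case pv: (p v) => [b|]; first by rewrite (pq _ _ pv) (pq' _ _ pv).
have := g_eq v; rewrite !inE pv /=.
have: (v \in supp q) = (v \in supp q') by rewrite sq sq'.
rewrite -{1 2}sq !inE.
by case: (q v) => [[]|]; case: (q' v) => [[]|].
Qed.

Section Step.
Variables (B : {set pattern V}) (v : V).
Hypotheses (B_blank : blank \in B)
  (B_nested : {in B &, forall p q,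
     (supp p \subset supp q) || (supp q \subset supp p)})
  (B_off : {in B, forall p, p v = None}).

Lemma law_children M t b : law M -> t \in B ->
  \sum_(c in children B t) M (upd c v (Some b)) <= M (upd t v (Some b)).
Proof.
move=> [Omega [w [X [w_ge0 _ Mw]]]] Bt; rewrite -subr_ge0.
pose u i := if X i v == b then w i else 0.
have Mu c : c \in B ->
    M (upd c v (Some b)) = \sum_(i | ple c (full (X i))) u i.
  move=> Bc; rewrite Mw -big_mkcondr; apply: eq_bigl => i.
  by rewrite upd_ple ?B_off.
rewrite Mu // (eq_bigr (fun c => \sum_(i | ple c (full (X i))) u i)).
  rewrite -/(atom B (fun c => \sum_(i | ple c (full (X i))) u i) t) atom_mass //.
  by apply: sumr_ge0 => i _; rewrite /u; case: ifP.
by move=> c; rewrite inE => /andP[/Mu].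
Qed.

(** The new node [v] gets value [b] with conditional probability
    [atom B Yb t / atom B Y t] on the cell of [t], where [Yb t] is the
    prescribed probability of [t] with [v] set to [b].  The hypotheses make
    these ratios a probability law on each cell, and summing over the cells
    above [t] telescopes to the prescribed value. *)
Lemma law_extend M Y : law M -> {in B, M =1 Y} ->
    {in B, forall t,
       Y (upd t v (Some true)) + Y (upd t v (Some false)) = Y t} ->
    {in B, forall t b,
       \sum_(c in children B t) Y (upd c v (Some b)) <= Y (upd t v (Some b))} ->
  exists M', [/\ law M', forall p, p v = None -> M' p = M p &
    {in B, forall t b, M' (upd t v (Some b)) = Y (upd t v (Some b))}].
Proof.
move=> [Omega [w [X [w_ge0 w1 Mw]]]] MY Y_split Y_children.
pose Yb b t := Y (upd t v (Some b)).
have atom_ge0 b t : t \in B -> 0 <= atom B (Yb b) t.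
  by move=> Bt; rewrite subr_ge0 Y_children.
have atom_split t : t \in B ->
    atom B Y t = atom B (Yb true) t + atom B (Yb false) t.
  move=> Bt; rewrite /atom -Y_split // addrACA -opprD -big_split /=.
  congr (_ - _); apply: eq_bigr => c; rewrite inE => /andP[Bc _].
  by rewrite -Y_split.
(* On a cell of mass zero both numerators vanish and any law will do. *)
pose r t (b : bool) : R :=
  if atom B Y t == 0 then b%:R else atom B (Yb b) t / atom B Y t.
have r_ge0 t b : t \in B -> 0 <= r t b.
  move=> Bt; rewrite /r; case: ifP => _; first by rewrite ler0n.
  apply: divr_ge0; first exact: atom_ge0.
  by rewrite atom_split // addr_ge0 ?atom_ge0.
have r_sum t : t \in B -> r t true + r t false = 1.
  move=> Bt; rewrite /r; case: ifP => [_|/negbT neq0]; first by rewrite addr0.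
  by rewrite -mulrDl -atom_split // divff.
have r_atom t b : t \in B -> r t b * atom B Y t = atom B (Yb b) t.
  move=> Bt; rewrite /r; case: eqP => [at0|/eqP neq0]; last by rewrite divfK.
  rewrite at0 mulr0; have := atom_split t Bt; rewrite at0 => /esym/eqP.
  by rewrite paddr_eq0 ?atom_ge0 // => /andP[/eqP a1 /eqP a0]; case: b.
pose m i := cell B (full (X i)).
have m_in i : m i \in B by apply: cell_in.
pose w' (j : Omega * bool) := w j.1 * r (m j.1) j.2.
pose X' (j : Omega * bool) u := if u == v then j.2 else X j.1 u.
have sumE (P : pred (Omega * bool)) : \sum_(j | P j) w' j =
    \sum_i ((if P (i, true) then w i * r (m i) true else 0) +
            (if P (i, false) then w i * r (m i) false else 0)).
  transitivity (\sum_i \sum_b if P (i, b) then w' (i, b) else 0).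
    by rewrite big_mkcond pair_bigA; apply: eq_bigr => -[].
  by apply: eq_bigr => i _; rewrite big_bool.
exists (fun p => \sum_(j | ple p (full (X' j))) w' j); split.
- exists (Omega * bool)%type, w', X'; split=> //.
    by move=> j; rewrite mulr_ge0 ?r_ge0.
  rewrite sumE -[RHS]w1; apply: eq_bigr => i _ /=.
  by rewrite -mulrDr r_sum ?mulr1.
- move=> p pv; rewrite sumE Mw [RHS]big_mkcond; apply: eq_bigr => i _.
  have X'_p b : ple p (full (X' (i, b))) = ple p (full (X i)).
    by apply: (ple_full_except pv) => u /negbTE uv; rewrite /X' uv.
  rewrite !X'_p; case: ifP => _; last by rewrite addr0.
  by rewrite -mulrDr r_sum ?mulr1.
move=> t Bt b; rewrite -/(Yb b t) -(sum_atom B_blank B_nested (Yb b) Bt).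
rewrite sumE; transitivity (\sum_(i | ple t (full (X i))) w i * r (m i) b).
  rewrite [RHS]big_mkcond; apply: eq_bigr => i _.
  rewrite !upd_ple ?B_off //.
  have X'_t d : ple t (full (X' (i, d))) = ple t (full (X i)).
    by apply: (ple_full_except (B_off Bt)) => u /negbTE uv; rewrite /X' uv.
  rewrite !X'_t {1 2}/X' eqxx; case: ple; case: b; rewrite ?addr0 ?add0r //.
rewrite (partition_big m (fun s => (s \in B) && ple t s)) /=; last first.
  by move=> i ti; rewrite m_in /= ple_cell.
apply: eq_bigr => s /andP[Bs ts]; rewrite -r_atom //.
have ->: atom B Y s = \sum_(i | m i == s) w i.
  rewrite -atom_mass // /atom -MY // Mw; congr (_ - _); apply: eq_bigr => c.
  by rewrite inE => /andP[Bc _]; rewrite -MY.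
rewrite mulr_sumr; apply: eq_big => [i|i /andP[_ /eqP ->]]; last by rewrite mulrC.
rewrite -(ple_cell B_blank B_nested) // -/(m i).
by case: eqP => [->|]; rewrite ?andbF // andbT ts.
Qed.

End Step.
End Laws.

(** * Linear systems with coefficients 0, 1 and -1 *)

Lemma all_flatten (T : Type) (a : pred T) (ss : seq (seq T)) :
  all a (flatten ss) = all (all a) ss.
Proof. by elim: ss => //= s ss IHss; rewrite all_cat IHss. Qed.

Section Rows.
Variables (R : realType) (I J : finType).
Implicit Types (Z : {set I}) (P N Q : {set J}) (c : lin_constraint R (I + J)).

(** Membership coefficients keep every entry in [{0, 1, -1}] whatever the sets,
    even when [P] and [N] meet. *)
Definition row Z P N (eqn one : bool) : lin_constraint R (I + J) :=
  LinConstraint (fun a => match a with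
    | inl i => (i \in Z)%:R
    | inr p => (p \in P)%:R - (p \in N)%:R
    end) eqn one%:R.

Lemma satisfies_row Z P N eqn one (z : {ffun I -> R^o}) (y : {ffun J -> R^o}) :
  satisfies z y (row Z P N eqn one) =
  let a := \sum_(i in Z) z i + (\sum_(p in P) y p - \sum_(p in N) y p) in
  if eqn then a == one%:R else a <= one%:R.
Proof.
have indE (K : finType) (A : {set K}) (x : {ffun K -> R^o}) :
    \sum_i (i \in A)%:R * x i = \sum_(i in A) x i.
  by rewrite [RHS]big_mkcond; apply: eq_bigr => i _; rewrite mulr_natl mulrb.
rewrite /satisfies /= indE -(indE _ P) -(indE _ N) -sumrB.
by under [X in _ + X]eq_bigr do rewrite mulrBl.
Qed.

Definition coef_0_pm1 c :=
  (rhs c \in [:: 0; 1; -1]) && [forall j, lhs c j \in [:: 0; 1; -1]].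

Lemma coef_row Z P N eqn one : coef_0_pm1 (row Z P N eqn one).
Proof.
apply/andP; split; first by case: one; rewrite /= !inE eqxx ?orbT.
apply/forallP => -[i|p] /=; first by case: (i \in Z); rewrite !inE eqxx ?orbT.
by case: (p \in P); case: (p \in N);
  rewrite !inE ?subrr ?subr0 ?sub0r eqxx ?orbT.
Qed.

Definition supported Q c := [forall p, (p \notin Q) ==> (lhs c (inr p) == 0)].

Lemma supported_row Q Z P N eqn one :
  P \subset Q -> N \subset Q -> supported Q (row Z P N eqn one).
Proof.
move=> /fintype.subsetP PQ /fintype.subsetP NQ.
apply/forallP => p; apply/implyP => Qp /=.
by rewrite (contraNF (PQ p) Qp) (contraNF (NQ p) Qp) subrr.
Qed.

Lemma supported_sub Q Q' c : Q \subset Q' -> supported Q c -> supported Q' c.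
Proof.
move=> /fintype.subsetP QQ' /forallP supp_c; apply/forallP => p.
by apply/implyP => Q'p; apply: (implyP (supp_c p)); apply: contra Q'p; apply: QQ'.
Qed.

Definition restrict Q c : lin_constraint R (I + 'I_#|Q|) :=
  LinConstraint (fun a => match a with
    | inl i => lhs c (inl i)
    | inr j => lhs c (inr (enum_val j))
    end) (is_eqn c) (rhs c).

(** Rows are written with one auxiliary variable for each element of a large
    type [J]; only those in [Q] are kept, which loses nothing when [Q] contains
    the support of every row. *)
Definition system Q (cs : seq (lin_constraint R (I + J))) : lin_system R I :=
  LinSystem [seq restrict Q c | c <- cs].

Lemma satisfies_restrict Q c (z : {ffun I -> R^o}) (y : {ffun J -> R^o})
    (y' : {ffun 'I_#|Q| -> R^o}) :
    supported Q c -> (forall j, y' j = y (enum_val j)) ->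
  satisfies z y' (restrict Q c) = satisfies z y c.
Proof.
move=> /forallP supp_c yy'; rewrite /satisfies /=.
suff ->: \sum_p lhs c (inr p) * y p =
    \sum_(j < #|Q|) lhs c (inr (enum_val j)) * y' j by [].
rewrite (bigID (mem Q)) /= [X in _ + X]big1 ?addr0.
  by rewrite big_enum_val; apply: eq_bigr => j _; rewrite yy'.
by move=> p /(implyP (supp_c p))/eqP ->; rewrite mul0r.
Qed.

Lemma satisfies_system Q cs (z : {ffun I -> R^o}) (y : {ffun J -> R^o})
    (y' : {ffun 'I_#|Q| -> R^o}) :
    all (supported Q) cs -> (forall j, y' j = y (enum_val j)) ->
  all (satisfies z y') (constraints (system Q cs)) = all (satisfies z y) cs.
Proof.
move=> supp_cs yy'; rewrite all_map.
elim: cs supp_cs => //= c cs IHcs /andP[supp_c /IHcs ->].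
by rewrite (satisfies_restrict _ supp_c yy').
Qed.

Lemma projection_system Q cs (z : {ffun I -> R^o}) : all (supported Q) cs ->
  projection (system Q cs) z <->
  exists y : {ffun J -> R^o}, all (satisfies z y) cs.
Proof.
move=> supp_cs; split=> [[y' sat_y']|[y sat_y]].
  exists [ffun p => \sum_(j | enum_val j == p) y' j].
  rewrite -(satisfies_system _ supp_cs (y' := y')) // => j.
  by rewrite ffunE (big_pred1 j) // => i /=; rewrite (inj_eq enum_val_inj).
exists [ffun j => y (enum_val j)].
by rewrite (satisfies_system _ supp_cs (y := y)) // => j; rewrite ffunE.
Qed.

Lemma coefs_system Q cs : all coef_0_pm1 cs -> coefs_0_pm1 (system Q cs).
Proof.
rewrite /coefs_0_pm1 all_map; apply: sub_all => c /andP[/= -> /forallP coef_c].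
by apply/forallP => -[i|j]; apply: coef_c.
Qed.

End Rows.

(** * Eliminating the nodes *)

Section Elimination.
Variables (R : realType) (V I : finType).
Implicit Types (p q t : pattern V) (v : V) (o : seq V) (B T : {set pattern V}).
Implicit Types (G : hypergraph V) (M : pattern V -> R).

Definition erase v T := [set upd p v None | p in T].

(** The empty pattern is always a base: it is the root of the laminar forest,
    and it makes the pattern consisting of [v] alone available. *)
Definition bases v T :=
  [set upd p v None | p in [set p in T | (p v != None) || (p == blank)]].

Definition branches v B :=
  [set upd tb.1 v (Some tb.2) | tb in finset.setX B [set: bool]].

Fixpoint vars o T : {set pattern V} :=
  if o is v :: o' then branches v (bases v T) :|: vars o' (erase v T)
  else [set blank].

Definition base_rows B v t : seq (lin_constraint R (I + pattern V)) :=
  row R finset.set0 [set upd t v (Some true); upd t v (Some false)] [set t]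
      true false ::
  [seq row R finset.set0 [set upd c v (Some b) | c in children B t]
         [set upd t v (Some b)] false false | b <- [:: true; false]].

Fixpoint rows o T : seq (lin_constraint R (I + pattern V)) :=
  if o is v :: o' then
    flatten [seq base_rows (bases v T) v t | t <- enum (bases v T)] ++
    rows o' (erase v T)
  else [:: row R finset.set0 [set blank] finset.set0 true true].

(** Preserved when a node is eliminated, and strong enough for a beta-leaf of
    [G] to make the bases nested. *)
Definition admissible G o T :=
  [/\ blank \in T, {in T, forall p, {subset supp p <= o}} &
      {in T, forall p, p != blank -> supp p \in edges G}].

Lemma upd_blank v : upd blank v None = blank :> pattern V.
Proof. by apply/ffunP => u; rewrite !ffunE if_same. Qed.

Lemma branches_in v B t b : t \in B -> upd t v (Some b) \in branches v B.
Proof. by move=> Bt; apply/imsetP; exists (t, b); rewrite // !inE Bt. Qed.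

Lemma bases_sub v T : bases v T \subset erase v T.
Proof. by apply: imsetS; apply/fintype.subsetP => p; rewrite inE => /andP[]. Qed.

Lemma bases_blank v T : blank \in T -> blank \in bases v T.
Proof.
by move=> Tb; apply/imsetP; exists blank; rewrite ?upd_blank // inE Tb eqxx orbT.
Qed.

Lemma bases_off v T : {in bases v T, forall t, t v = None}.
Proof. by move=> _ /imsetP[p _ ->]; rewrite ffunE eqxx. Qed.

(** The edges containing a beta-leaf are nested, and stay so without it. *)
Lemma bases_nested G v o T : admissible G (v :: o) T -> beta_leaf G v ->
  {in bases v T &, forall p q,
     (supp p \subset supp q) || (supp q \subset supp p)}.
Proof.
have supp_blank : supp (blank : pattern V) = finset.set0.
  by apply/setP => u; rewrite !inE ffunE.
move=> [_ _ T_edges] leaf _ _ /imsetP[p p_in ->] /imsetP[q q_in ->].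
rewrite !supp_erase; move: p_in q_in; rewrite !inE.
have [-> _|p_neq] := eqVneq p blank.
  by rewrite supp_blank finset.set0D finset.sub0set.
have [-> _ _|q_neq] := eqVneq q blank.
  by rewrite supp_blank finset.set0D finset.sub0set orbT.
rewrite !orbF => /andP[Tp pv] /andP[Tq qv].
have vp: v \in supp p by rewrite inE; case: (p v) pv.
have vq: v \in supp q by rewrite inE; case: (q v) qv.
have /forallP/(_ (supp p)) := leaf; rewrite T_edges //=.
move=> /forallP/(_ (supp q)); rewrite T_edges //= vp vq /=.
by case/orP => sub_pq; apply/orP; [left|right]; apply: finset.setSD.
Qed.

Lemma admissible_erase G v o T : admissible G (v :: o) T ->
  admissible (del_node G v) o (erase v T).
Proof.
move=> [Tb T_supp T_edges]; split.
- by apply/imsetP; exists blank; rewrite ?upd_blank.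
- move=> _ /imsetP[p Tp ->] u; rewrite supp_erase !inE => /andP[uv pu].
  by have := T_supp p Tp u; rewrite !inE (negbTE uv); apply.
move=> _ /imsetP[p Tp ->] p_neq; rewrite supp_erase.
apply/imsetP; exists (supp p) => //; rewrite inE T_edges //=; last first.
  by apply: contraNneq p_neq => ->; rewrite upd_blank.
rewrite card_gt0 -supp_erase; apply: contraNneq p_neq => /setP supp0.
apply/eqP/ffunP => u; rewrite [RHS]ffunE; have := supp0 u; rewrite !inE.
by case: (upd p v None u).
Qed.

Lemma vars_single o T v b : blank \in T -> v \in o ->
  upd blank v (Some b) \in vars o T.
Proof.
elim: o T => [|u o IHo] T Tb //; rewrite inE => /orP[/eqP->|vo]; rewrite inE.
  by rewrite branches_in ?bases_blank.
rewrite IHo ?orbT //; apply/imsetP; exists blank => //.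
by rewrite upd_blank.
Qed.

(** A pattern is one of the variables created when its first node in the
    elimination order is processed. *)
Lemma vars_sub G o T : admissible G o T -> T \subset vars o T.
Proof.
elim: o G T => [|v o IHo] G T adm; apply/fintype.subsetP => p Tp.
  have [_ T_supp _] := adm; rewrite inE; apply/eqP/ffunP => u; rewrite ffunE.
  by have := T_supp p Tp u; rewrite inE; case: (p u) => // b /(_ isT).
rewrite inE; case pv: (p v) => [b|].
  apply/orP; left; rewrite -(updK None pv); apply: branches_in.
  by apply/imsetP; exists p; rewrite // inE Tp pv.
apply/orP; right; apply: (fintype.subsetP (IHo _ _ (admissible_erase adm))).
by apply/imsetP; exists p; rewrite // -pv upd_id.
Qed.

Lemma vars_supp G o T p : admissible G o T -> p \in vars o T ->
  {subset supp p <= o}.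
Proof.
elim: o G T => [|v o IHo] G T adm.
  by rewrite inE => /eqP-> u; rewrite inE ffunE.
have adm' := admissible_erase adm; rewrite inE => /orP[|/(IHo _ _ adm') sub u].
  case/imsetP => -[t b] /=; rewrite !inE andbT => Bt -> u.
  rewrite supp_upd => /setU1P[->|ut]; rewrite inE ?eqxx //; apply/orP; right.
  have [_ T_supp _] := adm'.
  exact: (T_supp t (fintype.subsetP (bases_sub v T) t Bt) u ut).
by move=> /sub uo; rewrite inE uo orbT.
Qed.

Lemma vars_off G v o T p : v \notin o -> admissible G (v :: o) T ->
  p \in vars o (erase v T) -> p v = None.
Proof.
move=> ov /admissible_erase adm /(vars_supp adm)/(_ v)/contra/(_ ov).
by rewrite inE; case: (p v).
Qed.

Lemma bases_vars G v o T : admissible G (v :: o) T ->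
  bases v T \subset vars o (erase v T).
Proof.
move=> /admissible_erase/vars_sub; apply: fintype.subset_trans.
exact: bases_sub.
Qed.

Lemma rows_supported G o T : admissible G o T ->
  all (supported (vars o T)) (rows o T).
Proof.
elim: o G T => [|v o IHo] G T adm.
  by rewrite /= supported_row // finset.sub0set.
have adm' := admissible_erase adm.
rewrite /= all_cat; apply/andP; split; last first.
  by apply: sub_all (IHo _ _ adm') => c; apply: supported_sub (finset.subsetUr _ _).
have br t b : t \in bases v T ->
    upd t v (Some b) \in branches v (bases v T) :|: vars o (erase v T).
  by move=> Bt; rewrite inE branches_in.
have ch t b : [set upd c v (Some b) | c in children (bases v T) t] \subset
    branches v (bases v T) :|: vars o (erase v T).
  apply/fintype.subsetP => _ /imsetP[c c_in ->]; apply: br.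
  by move: c_in; rewrite inE => /andP[].
rewrite all_flatten all_map; apply/seq.allP => t; rewrite mem_enum => Bt /=.
have base_in: t \in branches v (bases v T) :|: vars o (erase v T).
  by rewrite inE (fintype.subsetP (bases_vars adm)) ?orbT.
by rewrite !supported_row ?finset.subUset ?ch ?finset.sub1set ?br ?base_in.
Qed.

Lemma coef_rows o T : all (@coef_0_pm1 R I _) (rows o T).
Proof.
elim: o T => [|v o IHo] T; first by rewrite /= coef_row.
rewrite /= all_cat IHo andbT all_flatten all_map; apply/seq.allP => t _ /=.
by rewrite !coef_row.
Qed.

Lemma upd_inj v b B : {in B, forall p, p v = None} ->
  {in B &, injective (fun p => upd p v (Some b))}.
Proof.
move=> B_off p q Bp Bq /(congr1 (fun r => upd r v None)).
by rewrite !updK ?B_off.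
Qed.

Lemma satisfies_base_rows B v t (z : {ffun I -> R^o})
    (y : {ffun pattern V -> R^o}) :
    {in B, forall p, p v = None} -> t \in B ->
  all (satisfies z y) (base_rows B v t) =
  (y (upd t v (Some true)) + y (upd t v (Some false)) == y t) &&
  [forall b, \sum_(c in children B t) y (upd c v (Some b))
               <= y (upd t v (Some b))].
Proof.
move=> B_off Bt; rewrite /= !satisfies_row /= !big_set0 !add0r.
have sum_children b : \sum_(p in [set upd c v (Some b) | c in children B t]) y p
    = \sum_(c in children B t) y (upd c v (Some b)).
  rewrite big_imset //= => c d; rewrite !inE => /andP[Bc _] /andP[Bd _].
  exact: (upd_inj B_off).
rewrite !sum_children !big_set1 !subr_le0 big_setU1 ?big_set1 /=; last first.
  rewrite inE; apply/eqP => /ffunP/(_ v); by rewrite !ffunE eqxx.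
rewrite subr_eq0 andbT; congr (_ && _).
by apply/andP/forallP => [[yt yf] []|y_le].
Qed.

Lemma rows_complete G o T M (z : {ffun I -> R^o}) :
    uniq o -> admissible G o T -> beta_elim G o -> law M ->
  all (satisfies z [ffun p => M p]) (rows o T).
Proof.
move=> + + + M_law; elim: o G T => [|v o IHo] G T.
  move=> _ _ _; rewrite /= satisfies_row /= !big_set0 big_set1 ffunE.
  by rewrite law_blank // add0r subr0 eqxx.
move=> /andP[ov uo] adm /andP[leaf elim]; rewrite /= all_cat.
rewrite (IHo _ _ uo (admissible_erase adm)) // andbT.
rewrite all_flatten all_map; apply/seq.allP => t; rewrite mem_enum => Bt.
have [Tb _ _] := adm; have B_off := @bases_off v T.
rewrite [preim _ _ _]satisfies_base_rows // !ffunE law_split ?B_off // eqxx.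
apply/forallP => b; rewrite ffunE; under eq_bigr do rewrite ffunE.
apply: law_children => //; first exact: bases_blank.
exact: bases_nested adm leaf.
Qed.

Lemma rows_sound G o T (z : {ffun I -> R^o}) (y : {ffun pattern V -> R^o}) :
    uniq o -> admissible G o T -> beta_elim G o ->
    all (satisfies z y) (rows o T) ->
  exists2 M, law M & {in vars o T, M =1 y}.
Proof.
elim: o G T => [|v o IHo] G T.
  move=> _ _ _; rewrite /= satisfies_row /= !big_set0 big_set1 andbT add0r subr0.
  move=> /eqP y1; exists (fun p => (ple p (full xpredT))%:R); first exact: law_const.
  by move=> p; rewrite inE => /eqP->; rewrite blank_ple y1.
move=> /andP[ov uo] adm /andP[leaf elim]; rewrite /= all_cat => /andP[sat_v].
move=> /(IHo _ _ uo (admissible_erase adm) elim)[M M_law My].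
have [Tb _ _] := adm; have B_off := @bases_off v T.
have By t : t \in bases v T ->
    (y (upd t v (Some true)) + y (upd t v (Some false)) == y t) &&
    [forall b, \sum_(c in children (bases v T) t) y (upd c v (Some b))
               <= y (upd t v (Some b))].
  move=> Bt; rewrite -(satisfies_base_rows z) //.
  move: sat_v; rewrite all_flatten all_map => /seq.allP; apply.
  by rewrite mem_enum.
have [||M' [M'_law M'_off M'_on]] :=
    law_extend (bases_blank v Tb) (bases_nested adm leaf) B_off
      M_law (Y := y) (fun t Bt => My t (fintype.subsetP (bases_vars adm) t Bt)).
- by move=> t /By/andP[/eqP].
- by move=> t /By/andP[_ /forallP].
exists M' => // p; rewrite inE => /orP[|p_in].
  by case/imsetP => -[t b] /=; rewrite !inE andbT => Bt ->; apply: M'_on.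
by rewrite M'_off ?My // (vars_off ov adm).
Qed.

Lemma card_erase v T : (#|erase v T| <= #|T|)%N.
Proof. exact: leq_imset_card. Qed.

Lemma card_bases v T : (#|bases v T| <= #|T|)%N.
Proof. exact: leq_trans (subset_leq_card (bases_sub v T)) (card_erase v T). Qed.

Lemma card_vars o T : (#|vars o T| <= 1 + 2 * (size o * #|T|))%N.
Proof.
elim: o T => [|v o IHo] T; first by rewrite /= cards1.
rewrite (leq_trans (leq_card_setU _ _).1) // [size _]/= (mulSn (size o)).
rewrite mulnDr addnCA leq_add //.
  rewrite (leq_trans (leq_imset_card _ _)) // cardsX cardsT card_bool mulnC.
  by rewrite leq_mul2l card_bases.
apply: leq_trans (IHo _) _.
by rewrite leq_add2l !leq_mul2l card_erase orbT.
Qed.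

Lemma size_rows o T : (size (rows o T) <= 1 + 3 * (size o * #|T|))%N.
Proof.
elim: o T => [|v o IHo] T //.
rewrite size_cat [size (v :: o)]/= (mulSn (size o)) mulnDr addnCA leq_add //.
  rewrite size_flatten /shape -map_comp sumnE big_map.
  rewrite (eq_bigr (fun=> 3%N)) // big_const_seq count_predT -cardE iter_addn_0.
  by rewrite leq_mul2l card_bases.
apply: leq_trans (IHo _) _.
by rewrite leq_add2l !leq_mul2l card_erase orbT.
Qed.

End Elimination.

(** * The pseudo-Boolean polytope *)

Section Polytope.
Variables (R : realType) (V : finType) (S : {set sedge V}).
Implicit Types (s : sedge V) (x : V -> bool) (z : {ffun pbvar S -> R^o}).

Lemma prod_literal s x :
  \prod_(v in uedge s) literal s v (x v)%:R =
  (ple (sgn s) (full x))%:R :> R.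
Proof.
case: (boolP (ple _ _)) => [/pleP s_le|].
  rewrite big1 // => v; rewrite /literal => /suppP[b sv].
  have := s_le v b sv; rewrite sv ffunE => -[->].
  by case: b {sv}; rewrite ?subr0.
rewrite /ple negb_forall => /existsP[v]; rewrite negb_or ffunE.
case sv: (sgn s v) => [b|] //=; rewrite (inj_eq Some_inj) => xv.
rewrite (bigD1 v) /=; last by rewrite inE sv.
rewrite /literal sv; move: xv.
by case: b {sv}; case: (x v) => //= _; rewrite ?subrr mul0r.
Qed.

Definition vertex x : {ffun pbvar S -> R^o} :=
  [ffun a => match a with
    | inl v => (x v)%:R
    | inr s => (ple (sgn (val s)) (full x))%:R
    end].

Lemma vertex_in x : @pb_set R V S (vertex x).
Proof.
split=> [i|s].
  rewrite ffunE; case: i => [v|s]; [case: (x v) | case: ple];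
    by [right|left].
by rewrite ffunE -prod_literal; apply: eq_bigr => v _; rewrite ffunE.
Qed.

Lemma pb_setP z : @pb_set R V S z -> z = vertex (fun v => z (inl v) == 1).
Proof.
move=> [z01 z_prod]; apply/ffunP => a; rewrite ffunE.
have zE v : z (inl v) = (z (inl v) == 1)%:R.
  by case: (z01 (inl v)) => ->; rewrite ?eqxx // eq_sym oner_eq0.
case: a => [v|s]; first exact: zE.
by rewrite z_prod -prod_literal; apply: eq_bigr => v _; rewrite [in LHS]zE.
Qed.

(** The weights of a convex combination of vertices are a probability law on
    the corresponding assignments. *)
Lemma pb_polytopeP z : pb_polytope R S z <-> exists M,
  [/\ law M, forall v, z (inl v) = M (upd blank v (Some true)) &
      forall s : {s | s \in S}, z (inr s) = M (sgn (val s))].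
Proof.
split=> [[n [l [u [l_ge0 l1 u_in ->]]]]|[M [[Omega [w [X [w_ge0 w1 Mw]]]] zv zs]]].
  pose X i v := u i (inl v) == 1.
  have sumE a : (\sum_i l i *: u i) a = \sum_i l i * vertex (X i) a.
    rewrite sum_ffunE; apply: eq_bigr => i _.
    by rewrite ffunE {1}(pb_setP (u_in i)).
  exists (fun p => \sum_(i | ple p (full (X i))) l i); split.
  - by exists 'I_n, l, X.
  - move=> v; rewrite sumE [RHS]big_mkcond; apply: eq_bigr => i _.
    by rewrite ffunE single_ple mulr_natr mulrb; case: (X i v).
  move=> s; rewrite sumE [RHS]big_mkcond; apply: eq_bigr => i _.
  by rewrite ffunE mulr_natr mulrb.
have enumE (F : Omega -> R) : \sum_(j < #|Omega|) F (enum_val j) = \sum_i F i.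
  by rewrite -(big_enum_val F); apply: eq_bigl.
exists #|Omega|, (fun j => w (enum_val j)), (fun j => vertex (X (enum_val j))).
split=> [//|||]; [by rewrite enumE | by move=> j; apply: vertex_in |].
apply/ffunP => a; rewrite sum_ffunE.
transitivity (\sum_i w i * vertex (X i) a); last first.
  by rewrite -enumE; apply: eq_bigr => j _; rewrite [RHS]ffunE.
case: a => [v|s]; rewrite ?zv ?zs Mw big_mkcond; apply: eq_bigr => i _.
  by rewrite ffunE single_ple mulr_natr mulrb; case: (X i v).
by rewrite ffunE mulr_natr mulrb.
Qed.

Section Formulation.
Variables (f : sedge V -> sedge V) (k : nat).
Hypotheses (f_min : forall s, s \in S -> min_maximal_over S s (f s))
  (f_gap : forall s, s \in S -> (sgap [set s; f s]%SET <= k)%N).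

Definition family : {set pattern V} :=
  blank |: \bigcup_(s in S) completions (uedge (f s)) (sgn s).

(** Expresses an original variable through the auxiliary ones: a node by the
    pattern that sets it to 1, a signed edge by its completions on the edge
    chosen for it. *)
Definition link (a : pbvar S) : lin_constraint R (pbvar S + pattern V) :=
  row R [set a] finset.set0
    match a with
    | inl v => [set upd blank v (Some true)]
    | inr s => completions (uedge (f (val s))) (sgn (val s))
    end true false.

Lemma satisfies_link z (y : {ffun pattern V -> R^o}) a :
  satisfies z y (link a) = (z a == match a with
    | inl v => y (upd blank v (Some true))
    | inr s => \sum_(q in completions (uedge (f (val s))) (sgn (val s))) y q
    end).
Proof.
rewrite satisfies_row /= big_set1 big_set0 add0r subr_eq0.
by case: a => [v|s]; rewrite ?big_set1.
Qed.

Lemma card_fiber s : s \in S ->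
  (#|completions (uedge (f s)) (sgn s)| <= 2 ^ k)%N.
Proof.
move=> Ss; have [_ sub_s _] := f_min Ss.
apply: leq_trans (card_completions sub_s) _; rewrite leq_exp2l //.
apply: leq_trans (f_gap Ss).
rewrite /sgap /gap (bigD1 (uedge s)) /=; last first.
  by apply/imsetP; exists s; rewrite // !inE eqxx.
apply: leq_trans (leq_maxl _ _); apply: leq_sub2r; apply: subset_leq_card.
apply: (finset.bigcup_sup (uedge (f s)) (F := id)).
by apply/imsetP; exists (f s); rewrite // !inE eqxx orbT.
Qed.

Lemma card_family : (#|family| <= 1 + #|S| * 2 ^ k)%N.
Proof.
rewrite (leq_trans (leq_card_setU _ _).1) // cards1 leq_add2l.
rewrite -sum_nat_const; elim/big_rec2: _ => [|s n A Ss le_A].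
  by rewrite cards0.
by rewrite (leq_trans (leq_card_setU _ _).1) // leq_add // card_fiber.
Qed.

Lemma family_admissible (o : seq V) : (forall v, v \in o) ->
  admissible (underlying (maximal S)) o family.
Proof.
move=> o_all; split=> [|p _ u _ //|p]; first by rewrite !inE eqxx.
move=> /setU1P[->|/finset.bigcupP[s Ss]]; first by rewrite eqxx.
rewrite inE => /andP[/eqP -> _] _; apply/imsetP; exists (f s) => //.
by case: (f_min Ss).
Qed.

Lemma fiber_vars (o : seq V) s : (forall v, v \in o) -> s \in S ->
  completions (uedge (f s)) (sgn s) \subset vars o family.
Proof.
move=> /family_admissible/vars_sub sub_vars Ss.
apply: fintype.subset_trans sub_vars.
apply: fintype.subset_trans (finset.subsetUr _ _).
exact: (finset.bigcup_sup s (F := fun s => completions (uedge (f s)) (sgn s))).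
Qed.

Lemma links_supported (o : seq V) : (forall v, v \in o) ->
  all (supported (vars o family)) [seq link a | a <- enum (pbvar S)].
Proof.
move=> o_all; rewrite all_map; apply/seq.allP => a _.
apply: supported_row; first exact: finset.sub0set.
case: a => [v|[s Ss]]; last exact: fiber_vars.
by rewrite finset.sub1set vars_single // !inE eqxx.
Qed.

Lemma formulation_exists : beta_acyclic (underlying (maximal S)) ->
  exists F : lin_system R (pbvar S),
    let N := (#|V| + #|S| + (1 + 3 * (#|V| * (1 + #|S| * 2 ^ k))))%N in
    [/\ extended_formulation F (pb_polytope R S),
        (nvars F <= N)%N, (nconstraints F <= N)%N & coefs_0_pm1 F].
Proof.
move=> [o /= o_perm o_elim].
have o_all v : v \in o by rewrite (perm_mem o_perm) mem_enum inE.
have o_uniq : uniq o by rewrite (perm_uniq o_perm) enum_uniq.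
have o_size : size o = #|V| by rewrite (perm_size o_perm) -cardE cardsT.
have adm := family_admissible o_all.
pose Q := vars o family.
pose cs := [seq link a | a <- enum (pbvar S)] ++ rows R _ o family.
have card_pbvar : #|pbvar S| = (#|V| + #|S|)%N by rewrite card_sum card_sig.
have supp_cs : all (supported Q) cs.
  by rewrite all_cat links_supported // (rows_supported R _ adm).
exists (system Q cs); split.
- apply/seteqP; split=> z.
    move=> /(projection_system z supp_cs)[y].
    rewrite all_cat all_map => /andP[/seq.allP z_link].
    move=> /(rows_sound o_uniq adm o_elim)[M M_law My].
    have {}z_link a := z_link a (mem_enum _ a).
    apply/pb_polytopeP; exists M; split=> // [v|[s Ss]].
      have := z_link (inl v); rewrite [preim _ _ _]satisfies_link => /eqP->.
      by rewrite My // vars_single // !inE eqxx.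
    have := z_link (inr (exist _ s Ss)).
    rewrite [preim _ _ _]satisfies_link => /eqP->.
    have [_ sub_s _] := f_min Ss; rewrite (law_completions M_law sub_s).
    apply: eq_bigr => q q_in.
    by rewrite My // (fintype.subsetP (fiber_vars o_all Ss)).
  move=> /pb_polytopeP[M [M_law zv zs]]; apply/(projection_system z supp_cs).
  exists [ffun p => M p]; rewrite all_cat (rows_complete _ o_uniq adm) // andbT.
  rewrite all_map; apply/seq.allP => a _; rewrite [preim _ _ _]satisfies_link.
  case: a => [v|[s Ss]]; first by rewrite ffunE zv.
  have [_ sub_s _] := f_min Ss; rewrite zs (law_completions M_law sub_s).
  by apply/eqP; apply: eq_bigr => q _; rewrite ffunE.
- rewrite /nvars /= card_pbvar leq_add2l (leq_trans (card_vars _ _)) //.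
  by rewrite o_size leq_add2l leq_mul // leq_mul2l card_family orbT.
- rewrite /nconstraints /= size_map size_cat size_map -cardE card_pbvar.
  rewrite leq_add2l (leq_trans (size_rows _ _ _ _)) //.
  by rewrite o_size leq_add2l !leq_mul2l card_family !orbT.
apply: coefs_system; rewrite all_cat coef_rows andbT.
by rewrite all_map; apply/seq.allP => a _; apply: coef_row.
Qed.
End Formulation.
End Polytope.

(** * Size bounds *)

(** With all four factors positive, [n], [m], [1] and [n * m * 2 ^ k] are each at
    most [X = 2 ^ k * n * m], and the left side is at most
    [4 * n + m + 1 + 3 * X]. *)
Lemma size_bound r k n m : (0 < r)%N -> (0 < n)%N -> (0 < m)%N ->
  (n + m + (1 + 3 * (n * (1 + m * 2 ^ k))) <= 9 * (r * 2 ^ k * n * m))%N.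
Proof.
move=> r0 n0 m0; have x0: (0 < 2 ^ k)%N by rewrite expn_gt0.
apply: (@leq_trans (9 * (2 ^ k * n * m))); last first.
  by rewrite leq_mul2l -!mulnA leq_pmull.
move: (2 ^ k)%N x0 => x x0.
have nX : (n <= x * n * m)%N by rewrite mulnAC leq_pmull ?muln_gt0 ?x0.
have mX : (m <= x * n * m)%N by rewrite leq_pmull ?muln_gt0 ?x0.
have oX : (1 <= x * n * m)%N by rewrite !muln_gt0 x0 n0.
rewrite mulnDr muln1 (_ : n * (m * x) = x * n * m)%N; last first.
  by rewrite mulnA mulnC mulnA.
move: (x * n * m)%N nX mX oX => X nX mX oX.
lia.
Qed.

(** [u] is squared because it may be negative, while the right side has to be
    at least 1 in the degenerate case [u <= 1], where [k = 0]. *)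
Lemma pow2_le_poly (R : realType) (c u : R) (k : nat) : 0 <= c ->
    k%:R <= c * ln u ->
  (2 ^ k)%N%:R <= 1 + (u ^+ 2) ^+ Num.bound c.
Proof.
move=> c_ge0 le_k; have [u_le1 | u_gt1] := leP u 1.
  have: k%:R <= (0 : R) by apply: le_trans le_k _; rewrite mulr_ge0_le0 ?ln_le0.
  rewrite pmulrn lern0 => /eqP->; rewrite expn0 lerDl.
  by rewrite exprn_ge0 ?sqr_ge0.
have u_gt0 : 0 < u by apply: lt_trans u_gt1.
have le_kN : k%:R <= ln (u ^+ Num.bound c).
  rewrite lnXn // -[leRHS]mulr_natl (le_trans le_k) // ler_wpM2r ?ln_ge0 ?ltW //.
  exact: archi_boundP.
rewrite natrX (@le_trans _ _ (sequences.expR 1 ^+ k)) //.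
  by rewrite lerXn2r ?nnegrE ?expR_ge0 // (le_trans _ (expR_ge1Dx 1)).
rewrite -expRM_natl mulr1 (@le_trans _ _ (u ^+ Num.bound c)) //.
  by rewrite -[leRHS]lnK ?posrE ?exprn_gt0 // ler_expR.
rewrite (@le_trans _ _ ((u ^+ 2) ^+ Num.bound c)) ?lerDr //.
by apply: lerXn2r; rewrite ?nnegrE ?sqr_ge0 ?(ltW u_gt0) // expr2 ler_pMr // ltW.
Qed.

Theorem proposition3 (R : realType) :
  (exists C : nat,
     forall (V : finType) (S : {set sedge V}) (f : sedge V -> sedge V)
       (k : nat),
       S != finset.set0 ->
       (forall s, s \in S -> min_maximal_over S s (f s)) ->
       (forall s, s \in S -> (sgap [set s; f s]%SET <= k)%N) ->
       beta_acyclic (underlying (maximal S)) ->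
       exists F : lin_system R (pbvar S),
         [/\ extended_formulation F (pb_polytope R S),
             (nvars F <= C * (srank S * 2 ^ k * #|V| * #|S|))%N,
             (nconstraints F <= C * (srank S * 2 ^ k * #|V| * #|S|))%N &
             coefs_0_pm1 F])
  /\
  (forall (p : {poly {poly R}}) (c : R), 0 <= c ->
     exists q : {poly {poly R}},
       forall (V : finType) (S : {set sedge V}) (f : sedge V -> sedge V)
         (k : nat),
         (forall s, s \in S -> min_maximal_over S s (f s)) ->
         (forall s, s \in S -> (sgap [set s; f s]%SET <= k)%N) ->
         beta_acyclic (underlying (maximal S)) ->
         k%:R <= c * ln (p.[#|V|%:R, #|S|%:R]) ->
         exists F : lin_system R (pbvar S),
           [/\ extended_formulation F (pb_polytope R S),
               (nvars F)%:R <= q.[#|V|%:R, #|S|%:R],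
               (nconstraints F)%:R <= q.[#|V|%:R, #|S|%:R] &
               coefs_0_pm1 F]).
Proof.
split.
  exists 9%N => V S f k /set0Pn[s Ss] f_min f_gap acyclic.
  have [F [FP vars_le rows_le coefF]] :=
    formulation_exists R f_min f_gap acyclic.
  have rank_gt0 : (0 < srank S)%N.
    rewrite /srank (bigD1 s) //= (leq_trans _ (leq_maxl _ _)) //.
    exact: ltnW (sedge_card s).
  have V_gt0 : (0 < #|V|)%N.
    exact: leq_trans (ltnW (sedge_card s)) (max_card _).
  have S_gt0 : (0 < #|S|)%N by apply/card_gt0P; exists s.
  have le_N := size_bound k rank_gt0 V_gt0 S_gt0.
  by exists F; split=> //;
    [apply: leq_trans vars_le le_N | apply: leq_trans rows_le le_N].
move=> p c c_ge0.
exists ('X + 'Y + (1 + 3%:R * ('X * (1 + 'Y * (1 + (p ^+ 2) ^+ Num.bound c))))).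
move=> V S f k f_min f_gap acyclic k_le.
have [F [FP vars_le rows_le coefF]] := formulation_exists R f_min f_gap acyclic.
have pow_le := pow2_le_poly c_ge0 k_le.
set N := (#|V| + #|S| + _)%N in vars_le rows_le.
set q := (X in horner (horner X _) _).
have N_le : N%:R <= q.[#|V|%:R, #|S|%:R].
  rewrite /q !hornerE /= /N !(natrD, natrM) -!addrA -!mulrA !lerD2l.
  by rewrite !ler_wpM2l ?addr_ge0 // lerD2l ler_wpM2l.
by exists F; split=> //; rewrite (le_trans _ N_le) ?ler_nat.
Qed.
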